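(* Let $P:\mathcal{K}\to\mathbb{R}$ be a function defined on an arbitrary family $\mathcal{K}$ of conditional events. Then $P$ is coherent according to the betting scheme if and only if $P$ is coherent according to the penalty criterion.
   Context: Events are elements of a Boolean algebra (with sure event $\Omega$, impossible event $\emptyset$); $\overline{E}$ is the negation of $E$, $EH$ is the conjunction, and an event is identified with its $\{0,1\}$-valued indicator. A conditional event $E|H$ has $H\neq\emptyset$. For a finite family $\mathcal{F}=\{E_1|H_1,\ldots,E_n|H_n\}$, put $\mathcal{H}_n=H_1\vee\cdots\vee H_n$. The constituents generated by $\mathcal{F}$ are the non-impossible conjunctions $A_1\cdots A_n$ with $A_i\in\{E_iH_i,\overline{E}_iH_i,\overline{H}_i\}$; those which logically imply $\mathcal{H}_n$ are denoted $C_1,\ldots,C_m$, and $C_0=\overline{H}_1\cdots\overline{H}_n$ (if it is not impossible). Betting scheme: $P$ is coherent if, for every integer $n$, every finite subfamily $\mathcal{F}=\{E_1|H_1,\ldots,E_n|H_n\}$ of $\mathcal{K}$, with $p_i=P(E_i|H_i)$, and all real numbers $s_1,\ldots,s_n$, one has $\min G_{\mathcal{H}_n}\le 0\le\max G_{\mathcal{H}_n}$, where $G=\sum_{i=1}^n s_iH_i(E_i-p_i)$ and $G_{\mathcal{H}_n}$ is its restriction to $\mathcal{H}_n$ (with values those of $G$ on $C_1,\ldots,C_m$). Penalty criterion: for $\mathcal{P}=(p_1,\ldots,p_n)\in\mathbb{R}^n$, the loss is $\mathcal{L}=\sum_{i=1}^n H_i(E_i-p_i)^2$, with value $L_h$ on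 the constituent $C_h$; for another point $\mathcal{P}^*=(p_1^*,\ldots,p_n^* )\in\mathbb{R}^n$ the loss is $\mathcal{L}^*=\sum_{i=1}^n H_i(E_i-p_i^* )^2$ with values $L_h^*$. $P$ is coherent if, for every integer $n$ and every finite subfamily $\mathcal{F}=\{E_1|H_1,\ldots,E_n|H_n\}$ of $\mathcal{K}$, with $\mathcal{P}=(p_1,\ldots,p_n)$ the restriction of $P$ to $\mathcal{F}$, there does not exist $\mathcal{P}^*$ such that $L_h^*\le L_h$ for every $h$, with $L_h^*<L_h$ for at least one index $h$. *)

(* Defs.v *)
From HB Require Import structures.
From mathcomp Require Import all_boot all_order all_algebra.
From mathcomp Require Import classical_sets reals.

Set Implicit Arguments.
Unset Strict Implicit.
Unset Printing Implicit Defensive.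

Import Order.TTheory GRing.Theory Num.Theory.

Local Open Scope ring_scope.

(** Events are the elements of a Boolean algebra [B], rendered as a
    [ctbDistrLatticeType]: [\top] is the sure event, [\bot] the impossible one,
    [~` E] is negation, [E `&` H] is conjunction, and [C <= E] means that [C]
    logically implies [E]. *)

(** A conditional event is a pair [E|H]; [E|H] and [EH|H] are not identified, and
    may both belong to a family. *)
Record condEvent (d : Order.disp_t) (B : ctbDistrLatticeType d) := CondEvent {
  event : B;
  hyp : B;
  hyp_neq0 : hyp != \bot%O }.

(** The three alternatives for [A_i]: [E_i H_i], [~E_i H_i] and [~H_i]. *)
Definition alternative (d : Order.disp_t) (B : ctbDistrLatticeType d)
    (x : condEvent B) (a : option bool) : B :=
  match a with
  | Some true => (event x `&` hyp x)%O
  | Some false => (~` event x `&` hyp x)%O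
  | None => (~` hyp x)%O
  end.

Definition hyp_union (d : Order.disp_t) (B : ctbDistrLatticeType d) (n : nat)
    (F : 'I_n -> condEvent B) : B :=
  (\join_(i < n) hyp (F i))%O.

Definition constituents (d : Order.disp_t) (B : ctbDistrLatticeType d) (n : nat)
    (F : 'I_n -> condEvent B) : seq B :=
  [seq C <- [seq (\meet_(i < n) alternative (F i) (a i))%O
              | a : {ffun 'I_n -> option bool}] | C != \bot%O].

(** The constituents [C_1, ..., C_m], without [C_0]. *)
Definition inner_constituents (d : Order.disp_t) (B : ctbDistrLatticeType d)
    (n : nat) (F : 'I_n -> condEvent B) : seq B :=
  [seq C <- constituents F | (C <= hyp_union F)%O].

(** Value on the constituent [C] of the indicator of the event [E].  It is
    meaningful when [C] implies [E] or [~` E].  A constituent always decides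
    each [H_i], and decides [E_i] when it implies [H_i]; otherwise the value
    used for [E_i] below is multiplied by [H_i = 0]. *)
Definition indicator (R : realType) (d : Order.disp_t)
    (B : ctbDistrLatticeType d) (E C : B) : R :=
  ((C <= E)%O)%:R.

Definition gain (R : realType) (d : Order.disp_t) (B : ctbDistrLatticeType d)
    (n : nat) (F : 'I_n -> condEvent B) (p s : 'I_n -> R) (C : B) : R :=
  \sum_(i < n)
    s i * indicator R (hyp (F i)) C * (indicator R (event (F i)) C - p i).

Definition loss (R : realType) (d : Order.disp_t) (B : ctbDistrLatticeType d)
    (n : nat) (F : 'I_n -> condEvent B) (p : 'I_n -> R) (C : B) : R :=
  \sum_(i < n)
    indicator R (hyp (F i)) C * (indicator R (event (F i)) C - p i) ^+ 2.

(** Minimum and maximum of a nonempty list; the head is only a neutral initial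
    value. *)
Definition seq_min (R : realType) (v : seq R) : R :=
  \big[Num.min/head 0 v]_(x <- v) x.

Definition seq_max (R : realType) (v : seq R) : R :=
  \big[Num.max/head 0 v]_(x <- v) x.

(** The finite subfamilies of [K] are the injective [F : 'I_n -> K] with
    [n > 0].  For such [F] the list of the values of the gain is nonempty, since
    [hyp_union F != \bot]. *)
Definition betting_coherent (R : realType) (d : Order.disp_t)
    (B : ctbDistrLatticeType d) (K : set (condEvent B)) (P : K -> R) : Prop :=
  forall (n : nat) (F : 'I_n -> K) (s : 'I_n -> R), (0 < n)%N -> injective F ->
    let G := gain (fun i => val (F i)) (fun i => P (F i)) s in
    let values := [seq G C | C <- inner_constituents (fun i => val (F i))] in
    seq_min values <= 0 <= seq_max values.

Definition penalty_coherent (R : realType) (d : Order.disp_t)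
    (B : ctbDistrLatticeType d) (K : set (condEvent B)) (P : K -> R) : Prop :=
  forall (n : nat) (F : 'I_n -> K), (0 < n)%N -> injective F ->
    let L := loss (fun i => val (F i)) in
    let p := fun i => P (F i) in
    let Cs := inner_constituents (fun i => val (F i)) in
    ~ exists pstar : 'I_n -> R,
        (forall C, C \in Cs -> L pstar C <= L p C) /\
        (exists2 C, C \in Cs & L pstar C < L p C).

(* Main.v *)
Require Import Defs.
From HB Require Import structures.
From mathcomp Require Import all_boot all_order all_algebra.
From mathcomp Require Import classical_sets reals.
From mathcomp Require Import ring lra.

(** Moving the assessment from [p] to [p + s] changes the loss by
    [sum_i H_i s_i^2 - 2 G], where [G] is the gain at stakes [s] ([loss_shift]);
    so the gain is, to first order, half the decrease of the loss.

    If some stakes make the gain positive on every constituent, a small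
    multiple of them makes the linear term win over the quadratic one on the
    finitely many constituents, and the shifted assessment has a smaller loss on
    all of them.

    Conversely, let [p + s] dominate [p].  Then [2 G >= sum_i H_i s_i^2], so the
    gain is nonnegative, and positive on each constituent on which a conditional
    event with [s_i != 0] is not called off.  It may vanish on the others, but
    they disappear when the bets with [s_i = 0] are dropped: the constituents of
    the subfamily [{i | s_i != 0}] that imply the union of its conditioning
    events all have positive gain, which is a sure win.  To compare gains for the
    family and the subfamily, no refinement of constituents is needed: any
    constituent of the subfamily meets one of the family
    ([meet_constituent_neq0]), and the two give a common conditional event the
    same alternative, hence the same value ([bet_value_meet]). *)

Set Implicit Arguments.
Unset Strict Implicit.
Unset Printing Implicit Defensive.

Import Order.Theory GRing.Theory Num.Theory.

Local Open Scope ring_scope.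

(** * Constituents *)

Section Constituents.
Variables (d : Order.disp_t) (B : ctbDistrLatticeType d).
Implicit Types (x : condEvent B) (C D : B).

(** Distributivity in the form that generic distribution of iterated
    operations expects. *)
HB.instance Definition _ :=
  Monoid.isAddLaw.Build B (@Order.meet d B) (@Order.join d B)
    (@meetUl d B) (@meetUr d B).

Lemma le_compl_eq0 C D : (C <= D)%O -> (C <= ~` D)%O -> C = \bot%O.
Proof.
move=> CD CnD; apply/eqP; rewrite -lex0 -(meetxC D) lexI.
by rewrite CD CnD.
Qed.

Lemma le_alternative_hyp x a C : C != \bot%O -> (C <= alternative x a)%O ->
  (C <= hyp x)%O = (a != None).
Proof.
move=> C0; case: a => [[]|] /=; rewrite ?lexI.
- by case/andP.
- by case/andP.
- by move=> Cn; apply/negP => /le_compl_eq0/(_ Cn)/eqP; apply/negP.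
Qed.

Lemma le_alternative_event x b C : C != \bot%O ->
  (C <= alternative x (Some b))%O -> (C <= event x)%O = b.
Proof.
move=> C0; case: b => /=; rewrite lexI => /andP[] // Cn _.
by apply/negP => /le_compl_eq0/(_ Cn)/eqP; apply/negP.
Qed.

Lemma alternative_total x :
  (\join_(a : option bool) alternative x a)%O = \top%O.
Proof.
apply/eqP; rewrite -le1x.
have -> : (\top = (event x `&` hyp x) `|` (~` event x `&` hyp x)
                     `|` ~` hyp x :> B)%O.
  by rewrite -meetUl joinxC meet1x joinxC.
have sup a := @joins_sup _ _ _ a xpredT (alternative x) isT.
by rewrite !leUx (sup (Some true)) (sup (Some false)) (sup None).
Qed.

Variables (n : nat) (F : 'I_n -> condEvent B).

Lemma constituent_le (a : 'I_n -> option bool) i :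
  (\meet_(j < n) alternative (F j) (a j) <= alternative (F i) (a i))%O.
Proof. exact: (@meets_inf _ _ _ i). Qed.

(** Distributing the meet of the [n] trivial joins shows that the conjunctions
    of alternatives cover the sure event. *)
Lemma meet_constituent_neq0 C : C != \bot%O ->
  exists a : {ffun 'I_n -> option bool},
    (C `&` \meet_(i < n) alternative (F i) (a i))%O != \bot%O.
Proof.
move=> C0; apply/existsP; apply: contraNT C0 => /existsPn none.
rewrite -[C]meetx1.
have -> : (\top = \meet_(i < n) \join_(a : option bool)
                    alternative (F i) a :> B)%O.
  by rewrite big1 // => i _; apply: alternative_total.
rewrite bigA_distr_bigA big_distrr /= big1 // => a _.
by apply/eqP; move: (none a); rewrite negbK.
Qed.

Lemma inner_constituentP C :
  reflect (exists a : {ffun 'I_n -> option bool},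
             [/\ C = (\meet_(i < n) alternative (F i) (a i))%O, C != \bot%O
               & exists i, a i != None])
          (C \in inner_constituents F).
Proof.
apply: (iffP idP) => [|[a [-> C0 [i ai]]]].
  rewrite !mem_filter => /and3P[CH C0 /mapP[a _ Ca]].
  exists a; split=> //; apply/existsP; apply: contraNT C0 => /existsPn none.
  have CnH i : (C <= ~` hyp (F i))%O.
    have := constituent_le a i.
    by rewrite -Ca (eqP (negbNE (none i))).
  apply/eqP/(le_compl_eq0 CH); rewrite /hyp_union compl_joins.
  by apply/meetsP => i _; apply: CnH.
rewrite !mem_filter C0 /=; apply/andP; split.
  apply: (@joins_min _ _ _ i) => //.
  by rewrite (le_alternative_hyp C0 (constituent_le a i)).
by apply/mapP; exists a; rewrite ?mem_enum.
Qed.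

Lemma inner_constituents_neq_nil : (0 < n)%N -> inner_constituents F != [::].
Proof.
move=> n0; pose i := Ordinal n0.
have [a aH] := meet_constituent_neq0 (hyp_neq0 (F i)).
suff : (\meet_(i < n) alternative (F i) (a i))%O \in inner_constituents F.
  by case: (inner_constituents F).
apply/inner_constituentP; exists a; split=> //.
  by apply: contraNneq aH => ->; rewrite meetx0.
exists i.
by rewrite -(le_alternative_hyp aH (leIxr _ (constituent_le a i))) leIl.
Qed.

End Constituents.

(** * Values of bets *)

Section Values.
Variables (R : realType) (d : Order.disp_t) (B : ctbDistrLatticeType d).
Implicit Types (x : condEvent B) (C D : B) (v : seq R).

(** The alternatives are mutually exclusive, so [a] and [b] coincide; the value
    of [E] on [~H] is arbitrary, but is multiplied by [H = 0]. *)
Lemma bet_value_meet x a b C D (f : R -> R) : (C `&` D)%O != \bot%O ->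
    (C <= alternative x a)%O -> (D <= alternative x b)%O ->
  indicator R (hyp x) C * f (indicator R (event x) C) =
  indicator R (hyp x) D * f (indicator R (event x) D).
Proof.
move=> CD0 Ca Db.
have C0 : C != \bot%O by apply: contraNneq CD0 => ->; rewrite meet0x.
have D0 : D != \bot%O by apply: contraNneq CD0 => ->; rewrite meetx0.
have CDa : (C `&` D <= alternative x a)%O by rewrite leIxl.
have CDb : (C `&` D <= alternative x b)%O by rewrite leIxr.
rewrite /indicator (le_alternative_hyp C0 Ca) (le_alternative_hyp D0 Db).
have := le_alternative_hyp CD0 CDb.
rewrite (le_alternative_hyp CD0 CDa).
case: a b Ca Db CDa CDb => [a|] [b|] //= Ca Db CDa CDb _.
  rewrite (le_alternative_event C0 Ca) (le_alternative_event D0 Db).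
  by rewrite -(le_alternative_event CD0 CDa) (le_alternative_event CD0 CDb).
by rewrite !mul0r.
Qed.

Lemma seq_min_mem v : v != [::] -> seq_min v \in v.
Proof.
case: v => // y v _; rewrite /seq_min /= big_cons.
have : \big[Num.min/y]_(x <- v) x \in y :: v.
  elim: v => [|z v IH]; first by rewrite big_nil mem_head.
  rewrite big_cons; case: leP => _; first by rewrite !inE eqxx orbT.
  by move: IH; rewrite !inE => /orP[->|->]; rewrite ?orbT.
by case: leP => // _ _; rewrite mem_head.
Qed.

Lemma seq_min_le v y : y \in v -> seq_min v <= y.
Proof. by move=> vy; apply: ge_bigmin_seq. Qed.

Lemma seq_max_ge v y : y \in v -> y <= seq_max v.
Proof. by move=> vy; apply: le_bigmax_seq. Qed.

Variables (n : nat) (F : 'I_n -> condEvent B).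

Lemma gainZ (p s : 'I_n -> R) (t : R) C :
  gain F p (fun i => t * s i) C = t * gain F p s C.
Proof. by rewrite /gain mulr_sumr; apply: eq_bigr => i _; rewrite !mulrA. Qed.

Lemma loss_shift (p s : 'I_n -> R) C :
  loss F (fun i => p i + s i) C =
  loss F p C + \sum_(i < n) indicator R (hyp (F i)) C * s i ^+ 2
  - 2 * gain F p s C.
Proof.
rewrite /loss /gain mulr_sumr -sumrN -!big_split /=.
by apply: eq_bigr => i _; ring.
Qed.

End Values.

(** * The two criteria *)

Section Criteria.
Variables (R : realType) (d : Order.disp_t) (B : ctbDistrLatticeType d).
Variables (K : set (condEvent B)) (P : K -> R).

(** Replacing [s] by [-s] exchanges the two inequalities of the betting scheme,
    so coherence says that no stakes give a sure win. *)
Lemma betting_coherentP : betting_coherent P <->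
  forall (n : nat) (F : 'I_n -> K) (s : 'I_n -> R), (0 < n)%N -> injective F ->
  exists2 C, C \in inner_constituents (fun i => val (F i))
           & gain (fun i => val (F i)) (fun i => P (F i)) s C <= 0.
Proof.
split=> [coh n F s n0 injF|nowin n F s n0 injF /=].
  have /andP[min0 _] := coh n F s n0 injF.
  set v := map _ _ in min0.
  have v0 : v != [::].
    have := inner_constituents_neq_nil (fun i => val (F i)) n0.
    by rewrite /v; case: inner_constituents.
  by have /mapP[C CF Cmin] := seq_min_mem v0; exists C; rewrite // -Cmin.
apply/andP; split.
  have [C CF gain0] := nowin n F s n0 injF.
  by apply: le_trans gain0; apply: seq_min_le; apply: map_f.
have [C CF] := nowin n F (fun i => -1 * s i) n0 injF.
rewrite gainZ mulN1r oppr_le0 => gain0.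
by apply: (le_trans gain0); apply: seq_max_ge; apply: map_f.
Qed.

(** The gain is the directional derivative of half the decrease of the loss, so
    a sure win is a direction in which the loss decreases everywhere. *)
Lemma penalty_betting : penalty_coherent P -> betting_coherent P.
Proof.
move=> coh; apply/betting_coherentP => n F s n0 injF.
set G := gain _ _ s; set Cs := inner_constituents _.
apply/hasP; apply: contraT => /hasPn win; case: (coh n F n0 injF).
have Cs0 : Cs != [::] := inner_constituents_neq_nil _ n0.
have vals0 : map G Cs != [::] by move: Cs0; case: (Cs).
have g0 : 0 < seq_min (map G Cs).
  have /mapP[C CCs ->] := seq_min_mem vals0.
  by rewrite ltNge win.
set g := seq_min _ in g0.
pose q : R := \sum_(i < n) s i ^+ 2.
have q0 : 0 <= q by apply: sumr_ge0 => i _; apply: sqr_ge0.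
(* The step [t] satisfies [t * q < g], with [g] the least gain and [q] a bound
   on the quadratic term at stakes [s]. *)
pose t := g / (q + 1).
have t0 : 0 < t by rewrite divr_gt0 // ltr_wpDl.
have tq : t * q < g.
  by rewrite /t mulrAC ltr_pdivrMr ?ltr_wpDl // ltr_pM2l // ltrDl.
have lower C : C \in Cs ->
    loss (fun i => val (F i)) (fun i => P (F i) + t * s i) C
    < loss (fun i => val (F i)) (fun i => P (F i)) C.
  move=> CCs; rewrite loss_shift gainZ -/G.
  have gG : g <= G C by apply: seq_min_le; apply: map_f.
  have quad : \sum_(i < n) indicator R (hyp (val (F i))) C * (t * s i) ^+ 2
              <= t * (t * q).
    rewrite /q !mulr_sumr; apply: ler_sum => i _.
    rewrite exprMn (expr2 t) -[t * t * _]mulrA ler_piMl //.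
      by rewrite !(pmulr_rge0 _ t0) sqr_ge0.
    by rewrite /indicator lern1 leq_b1.
  have lin : t * (t * q) < t * G C by rewrite ltr_pM2l // (lt_le_trans tq).
  have tG : 0 < t * G C by rewrite mulr_gt0 // (lt_le_trans g0).
  by move: quad lin tG; set a := \sum_(i < n) _; set b := t * G C; lra.
exists (fun i => P (F i) + t * s i); split=> [C CCs|]; first exact/ltW/lower.
have headCs : head \bot%O Cs \in Cs.
  by move: Cs0; case: (Cs) => // C l; rewrite mem_head.
by exists (head \bot%O Cs); last exact: lower.
Qed.

(** The stakes are the displacements [s = q - p] of the dominating assessment
    [q], restricted to the conditional events that are actually displaced. *)
Lemma betting_penalty : betting_coherent P -> penalty_coherent P.
Proof.
move=> /betting_coherentP coh n F n0 injF L p Cs [q [qle [C1 C1Cs qlt]]].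
pose s i := q i - p i.
have lossE C : L q C = L p C
    + \sum_(i < n) indicator R (hyp (val (F i))) C * s i ^+ 2
    - 2 * gain (fun i => val (F i)) p s C.
  rewrite -loss_shift; apply: eq_bigr => i _.
  by have -> : p i + s i = q i by rewrite addrC subrK.
pose J := [pred i | s i != 0].
have J0 : (0 < #|J|)%N.
  apply/card_gt0P/existsP; apply: contraTT qlt => /existsPn noJ.
  rewrite -leNgt; apply: ler_sum => i _; suff -> : q i = p i by [].
  by apply/eqP; rewrite -subr_eq0; apply/negbNE; apply: noJ.
pose e (k : 'I_#|J|) : 'I_n := enum_val k.
have [||D DJ] := coh #|J| (F \o e) (s \o e); [by []| |].
  by apply: inj_comp => //; apply: enum_val_inj.
(* [C] is a constituent of the whole family that meets [D]; since [D] does not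
   call off the bet [k], neither does [C]. *)
have /inner_constituentP[b [Db D0 [k bk]]] := DJ.
have [a DC0] := meet_constituent_neq0 (fun i => val (F i)) D0.
set C := (\meet_(i < n) _)%O in DC0.
have Ca i : (C <= alternative (val (F i)) (a i))%O.
  by apply: (constituent_le (fun j => val (F j))).
have Dalt j : (D <= alternative (val (F (e j))) (b j))%O.
  by rewrite Db (constituent_le (fun l => val (F (e l)))).
have C0 : C != \bot%O by apply: contraNneq DC0 => ->; rewrite meetx0.
have CH : (C <= hyp (val (F (e k))))%O.
  rewrite (le_alternative_hyp C0 (Ca _)).
  rewrite -(le_alternative_hyp DC0 (leIxr D (Ca (e k)))).
  by rewrite (le_alternative_hyp DC0 (leIxl C (Dalt k))).
have CCs : C \in Cs.
  apply/inner_constituentP; exists a; split=> //; exists (e k).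
  by rewrite -(le_alternative_hyp C0 (Ca _)).
(* Bets with zero stake contribute nothing, and the others have the same value
   on [C] and on [D]. *)
have -> : gain (fun j => val ((F \o e) j)) (fun j => P ((F \o e) j)) (s \o e) D
          = gain (fun i => val (F i)) p s C.
  transitivity (\sum_(i in J) s i * indicator R (hyp (val (F i))) C
                  * (indicator R (event (val (F i))) C - p i)).
    rewrite big_enum_val; apply: eq_bigr => j _ /=; rewrite -!mulrA.
    congr (_ * _); apply/esym.
    apply: (bet_value_meet (fun y => y - p (e j)) _ (Ca _) (Dalt j)).
    by rewrite meetC.
  rewrite big_mkcond; apply: eq_bigr => i _; case: ifPn => //.
  by rewrite inE negbK => /eqP ->; rewrite !mul0r.
have quad : 0 < \sum_(i < n) indicator R (hyp (val (F i))) C * s i ^+ 2.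
  rewrite (bigD1 (e k)) //= ltr_wpDr //.
    by apply: sumr_ge0 => i _; rewrite mulr_ge0 ?ler0n ?sqr_ge0.
  rewrite /indicator CH mul1r exprn_even_gt0 //=.
  by have := enum_valP k.
have := qle C CCs; rewrite lossE; move: quad.
set Q := \sum_(i < n) _; set G := gain _ _ _ _; set l := L p C.
by move=> *; lra.
Qed.

End Criteria.

Theorem mainTheorem2 (R : realType) (d : Order.disp_t)
    (B : ctbDistrLatticeType d) (K : set (condEvent B)) (P : K -> R) :
  betting_coherent P <-> penalty_coherent P.
Proof. by split; [apply: betting_penalty | apply: penalty_betting]. Qed.
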